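(* Let $\{\xi_1,\xi_2,\ldots\}$ be independent nonnegative random variables with distribution functions $\{F_{\xi_1},F_{\xi_2},\ldots\}$, and let $\eta$ be a counting random variable with distribution function $F_\eta$, independent of $\{\xi_1,\xi_2,\ldots\}$. Let $S_\eta=\sum_{k=1}^{\eta}\xi_k$ be the random sum. Suppose that there is some $\kappa\in\operatorname{supp}(\eta)\setminus\{0\}$ such that the following five conditions are satisfied: (1) $F_{\xi_\kappa}\in\mathcal{OL}$; (2) for each $k\in\operatorname{supp}(\eta)$ with $1\leqslant k\leqslant\kappa$, either $\lim_{x\to\infty}\frac{\overline{F}_{\xi_k}(x)}{\overline{F}_{\xi_\kappa}(x)}=0$ or $F_{\xi_k}\in\mathcal{OL}$; (3) $\limsup_{x\to\infty}\,\sup_{k\geqslant 1}\frac{\overline{F}_{\xi_{\kappa+k}}(x-1)}{\overline{F}_{\xi_{\kappa+k}}(x)}<\infty$; (4) $\limsup_{k\to\infty}\frac{1}{k}\sum_{l=1}^{k}\sup_{x\geqslant 0}\big(\overline{F}_{\xi_{\kappa+l}}(x-1)-\overline{F}_{\xi_{\kappa+l}}(x)\big)<1$; (5) for each $\delta\in(0,1)$, $\overline{F}_\eta(\delta x)=O\big(\sqrt{x}\,\overline{F}_{\xi_\kappa}(x)\big)$ as $x\to\infty$. Then the distribution function $F_{S_\eta}$ of $S_\eta$ belongs to $\mathcal{OL}$.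
   Context: For a random variable $X$, $F_X(x)=\mathbb{P}(X\leqslant x)$ is its distribution function; for a distribution function $F$, $\overline{F}(x)=1-F(x)$, $x\in\mathbb{R}$, is its tail. A distribution function $F$ belongs to the class $\mathcal{OL}$ of $\mathcal{O}$-exponential distributions if for all $a\in\mathbb{R}$ $$0<\liminf_{x\to\infty}\frac{\overline{F}(x+a)}{\overline{F}(x)}\leqslant\limsup_{x\to\infty}\frac{\overline{F}(x+a)}{\overline{F}(x)}<\infty$$ (in particular, $\overline{F}(x)>0$ for all $x\in\mathbb{R}$). A counting random variable is an integer-valued, nonnegative random variable that is nondegenerate at zero (i.e. not almost surely equal to $0$). $\operatorname{supp}(\eta)=\{n\in\{0,1,2,\ldots\}:\mathbb{P}(\eta=n)>0\}$, so $\operatorname{supp}(\eta)\setminus\{0\}=\{n\in\mathbb{N}:\mathbb{P}(\eta=n)>0\}$ with $\mathbb{N}=\{1,2,\ldots\}$. Partial sums: $S_0=0$, $S_n=\xi_1+\cdots+\xi_n$ for $n\in\mathbb{N}$; $S_\eta=\sum_{k=1}^{\eta}\xi_k$ is the random sum, with distribution function $F_{S_\eta}(x)=\sum_{n=0}^\infty\mathbb{P}(\eta=n)\mathbb{P}(S_n\leqslant x)$. *)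

(* Defs.v *)
From HB Require Import structures.
From mathcomp Require Import all_boot all_order all_algebra finmap.
From mathcomp Require Import all_classical all_reals all_analysis.

Set Implicit Arguments.
Unset Strict Implicit.
Unset Printing Implicit Defensive.

Import Order.TTheory GRing.Theory Num.Theory.
Import numFieldNormedType.Exports.

Local Open Scope classical_set_scope.
Local Open Scope ring_scope.
Local Open Scope ereal_scope.

(* Lets the library's big-O notation be used at [+oo]. *)
Canonical pinfty_filter_on (R : realType) : filter_on R :=
  FilterType (pinfty_nbhs R) (@filter_filter _ _ proper_pinfty_nbhs).

Definition tail {R : realType} (F : R -> \bar R) : R -> \bar R :=
  fun x => 1 - F x.

(* Quotients of tails are taken in [\bar R], where [c / 0 = +oo] for [0 < c]
   and [0 / 0 = 0].  Hence a distribution function whose tail vanishes somewhere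
   (and so everywhere further right) has lower limit 0 and is not in [OL]. *)
Definition OL {R : realType} (F : R -> \bar R) : Prop :=
  forall a : R,
    [/\ 0 < limf_einf (fun x : R => tail F (x + a)%R / tail F x) +oo%R,
        limf_einf (fun x : R => tail F (x + a)%R / tail F x) +oo%R
          <= limf_esup (fun x : R => tail F (x + a)%R / tail F x) +oo%R &
        limf_esup (fun x : R => tail F (x + a)%R / tail F x) +oo%R < +oo].

Section independence.
Context {d : measure_display} {T : measurableType d} {R : realType}
  {P : probability T R}.

Definition mutually_independent (I : choiceType) (D : set I)
    (X : I -> {RV P >-> R}) : Prop :=
  forall (J : {fset I}) (B : I -> set R), [set` J] `<=` D ->
    (forall i, i \in J -> measurable (B i)) ->
    P (\bigcap_(i in [set` J]) (X i @^-1` B i)) =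
    \prod_(i <- J) P (X i @^-1` B i).

Definition generated_sigma (I : choiceType) (D : set I)
    (X : I -> {RV P >-> R}) : set (set T) :=
  <<s \bigcup_(i in D) preimage_set_system [set: T] (X i) measurable >>.

Definition independent_of_family d' (T' : measurableType d')
    (Y : {RV P >-> T'}) (I : choiceType) (D : set I)
    (X : I -> {RV P >-> R}) : Prop :=
  forall (A : set T') (E : set T), measurable A -> generated_sigma D X E ->
    P (Y @^-1` A `&` E) = P (Y @^-1` A) * P E.

End independence.

Section random_sums.
Context {d : measure_display} {T : measurableType d} {R : realType}
  {P : probability T R}.

Definition counting_RV (eta : {RV P >-> nat}) : Prop :=
  ~ {ae P, forall w, eta w = 0%N}.

Definition supp (eta : {RV P >-> nat}) : set nat :=
  [set n | 0 < P (eta @^-1` [set n])].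

Definition nat_RV_fun (eta : {RV P >-> nat}) : T -> R :=
  fun w => (eta w)%:R%R.

Lemma measurable_nat_RV_fun (eta : {RV P >-> nat}) :
  measurable_fun [set: T] (nat_RV_fun eta).
Proof.
apply: (measurableT_comp (f := fun n : nat => n%:R%R : R)) => //.
Qed.

HB.instance Definition _ (eta : {RV P >-> nat}) :=
  isMeasurableFun.Build _ _ _ _ (nat_RV_fun eta) (measurable_nat_RV_fun eta).

(* [eta] as a real random variable, so that it has a [cdf] on [R]. *)
Definition nat_RV (eta : {RV P >-> nat}) : {RV P >-> R} := nat_RV_fun eta.

(* The summands are indexed from 1; the value [xi 0] is never used. *)
Definition random_sum_fun (xi : nat -> {RV P >-> R}) (eta : {RV P >-> nat}) :
    T -> R :=
  fun w => (\sum_(1 <= k < (eta w).+1) xi k w)%R.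

Lemma measurable_random_sum_fun (xi : nat -> {RV P >-> R})
    (eta : {RV P >-> nat}) :
  measurable_fun [set: T] (random_sum_fun xi eta).
Proof.
move=> _ B mB; rewrite setTI.
have -> : random_sum_fun xi eta @^-1` B = \bigcup_n
   (eta @^-1` [set n] `&` (fun w => \sum_(1 <= k < n.+1) xi k w)%R @^-1` B).
  apply/seteqP; split => w /=; first by move=> Bw; exists (eta w).
  by move=> [n _ [/= <-]].
apply: bigcup_measurable => n _; apply: measurableI.
  by rewrite -[X in measurable X]setTI; exact: measurable_funPT.
rewrite -[X in measurable X]setTI.
suff : measurable_fun [set: T] (fun w => \sum_(1 <= k < n.+1) xi k w)%R by apply.
exact: measurable_sum.
Qed.

HB.instance Definition _ (xi : nat -> {RV P >-> R}) (eta : {RV P >-> nat}) :=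
  isMeasurableFun.Build _ _ _ _ (random_sum_fun xi eta)
    (measurable_random_sum_fun xi eta).

Definition random_sum (xi : nat -> {RV P >-> R}) (eta : {RV P >-> nat}) :
  {RV P >-> R} := random_sum_fun xi eta.

End random_sums.

(* Main.v *)
(* Write F for the tail of xi_kappa.  Membership in OL amounts to F > 0 together
   with F(x - 1) <= C F(x) for all real x.  Conditioning on an independent
   variable Y, this inequality passes from xi_kappa to xi_kappa + Y with the same
   C, whatever the law of Y.  Hence P(S_n > x - 1) <= C P(S_n > x) uniformly in
   n >= kappa.  For n < kappa nonnegativity gives S_n <= S_kappa, so
   P(S_n > x - 1) <= P(S_kappa > x - 1) <= C P(S_kappa > x), and
   P(S_kappa > x) <= P(S_eta > x) / P(eta = kappa). *)
Require Import Defs.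
From HB Require Import structures.
From mathcomp Require Import all_boot all_order all_algebra finmap.
From mathcomp Require Import all_classical all_reals all_analysis.
From mathcomp Require Import measurable_realfun ring lra.

Set Implicit Arguments.
Unset Strict Implicit.
Unset Printing Implicit Defensive.

Import Order.TTheory GRing.Theory Num.Theory.
Import numFieldNormedType.Exports.

Local Open Scope classical_set_scope.
Local Open Scope ring_scope.
Local Open Scope ereal_scope.

(** Two sets of a proper filter meet, and the value of [f] at a common point lies above the infimum
    over one and below the supremum over the other. *)
Lemma limf_einf_le_esup (R : realType) (U : choiceType) (T : filteredType U)
  (F : set_system T) (f : T -> \bar R) :
  ProperFilter F -> limf_einf f F <= limf_esup f F.
Proof.
move=> FF; rewrite limf_einfE limf_esupE.
apply: ge_ereal_sup => _ [V FV <-]; apply: le_ereal_inf_tmp => _ [W FW <-].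
have [x [Vx Wx]] := filter_ex (filterI FV FW).
by apply: (@le_trans _ _ (f x)); [apply: ereal_inf_lbound|apply: ereal_sup_ubound];
  exists x.
Qed.

(** * The class [OL] as a one-step inequality between tails *)

Section OL_cdf.
Context d (T : measurableType d) (R : realType) (P : probability T R).
Variable X : {RV P >-> R}.

Lemma tail_cdf : tail (cdf X) = ccdf X.
Proof. by apply/funext => x; rewrite ccdf_1_cdf. Qed.

(* Comparison at distance 1 holds for all [x] and not just near [+oo]: on a
   half-line bounded above the tail is bounded away from 0. *)
Lemma OL_ccdf_le : OL (cdf X) -> (forall x, 0 < ccdf X x) /\
  exists2 C : R, (0 <= C)%R & forall x, ccdf X (x - 1)%R <= C%:E * ccdf X x.
Proof.
rewrite /OL tail_cdf => XOL.
have ccdf_gt0 x : 0 < ccdf X x.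
  (* With shift 0 the ratio would be 0 / 0 = 0 at a zero of the tail. A positive lower limit
     excludes this beyond some [M], and monotonicity carries positivity back to [x]. *)
  have [+ _ _] := XOL 0%R; rewrite limf_einfE => /ereal_sup_gt[_ [V [M [_ MV]] <-]] V0.
  pose y := (Num.max x M + 1)%R.
  have xy : (x <= y)%R by rewrite /y; have := le_max x x M; rewrite lexx/=; lra.
  have /MV Vy : (M < y)%R.
    by rewrite /y; have := le_max M x M; rewrite lexx orbT; lra.
  apply: lt_le_trans (ccdf_nonincreasing X xy).
  rewrite lt_neqAle measure_ge0 andbT; apply/negP => /eqP y0.
  have : 0 < ccdf X (y + 0)%R / ccdf X y.
    by apply: (lt_le_trans V0); apply: ereal_inf_lbound; exists y.
  by rewrite addr0 -y0 mul0e ltxx.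
split=> //.
have [_ _] := XOL (-1)%R; rewrite limf_esupE.
move=> /ereal_inf_lt[_ [V [M [_ MV]] <-]] /=; set s := ereal_sup _ => soo.
have ratio_le x : (M < x)%R -> ccdf X (x - 1)%R / ccdf X x <= s.
  by move=> /MV Vx; apply: ereal_sup_ubound; exists x.
have s_ge0 : 0 <= s.
  apply: le_trans (ratio_le (M + 1)%R _); last lra.
  by rewrite mule_ge0 ?inve_ge0 ?measure_ge0.
have s_fin : s \is a fin_num by rewrite ge0_fin_numE.
pose g x := fine (ccdf X x).
have gE x : ccdf X x = (g x)%:E by rewrite fineK// fin_num_measure.
have g_gt0 x : (0 < g x)%R by rewrite -lte_fin -gE.
(* The first summand serves [x > M], where [s] bounds the ratio. The second serves [x <= M], where a
   tail is at most 1 and [g x >= g M]. *)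
exists (fine s + (g M)^-1)%R; first by rewrite addr_ge0 ?fine_ge0// invr_ge0 ltW.
move=> x; have [Mx|xM] := ltP M x.
  have := ratio_le _ Mx; rewrite !gE -(fineK s_fin) inver gt_eqF//.
  rewrite -!EFinM !lee_fin ler_pdivrMr// => /le_trans; apply.
  by rewrite /= ler_pM2r// lerDl invr_ge0 ltW.
apply: (le_trans (probability_le1 _ _)) => //.
have := ccdf_nonincreasing X xM; rewrite !gE -!EFinM !lee_fin => Mx.
apply: (@le_trans _ _ ((g M)^-1 * g x)%R).
  by rewrite mulrC ler_pdivlMr// mul1r.
by rewrite ler_pM2r// lerDr fine_ge0.
Qed.

(** Iterating the hypothesis gives [g (x - n) <= C ^+ n * g x]. For [n >= |a|], monotonicity and
    this bound at [x] and at [x + a] confine the ratio between [C ^- n] and [C ^+ n] on the whole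
    line. *)
Lemma ccdf_le_OL (C : R) : (forall x, 0 < ccdf X x) ->
  (forall x, ccdf X (x - 1)%R <= C%:E * ccdf X x) -> OL (cdf X).
Proof.
move=> ccdf_gt0 ccdfC; rewrite /OL tail_cdf => a.
pose g x := fine (ccdf X x).
have gE x : ccdf X x = (g x)%:E by rewrite fineK// fin_num_measure.
have g_gt0 x : (0 < g x)%R by rewrite -lte_fin -gE.
have g_le x y : (x <= y)%R -> (g y <= g x)%R.
  by move=> xy; rewrite -lee_fin -!gE ccdf_nonincreasing.
have gC x : (g (x - 1) <= C * g x)%R by rewrite -lee_fin EFinM -!gE.
have C_gt0 : (0 < C)%R.
  by rewrite -(pmulr_lgt0 _ (g_gt0 0%R)); exact: lt_le_trans (gC _).
have gCn n x : (g (x - n%:R) <= C ^+ n * g x)%R.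
  elim: n x => [|n IH] x; first by rewrite subr0 expr0 mul1r.
  rewrite (_ : x - n.+1%:R = x - n%:R - 1)%R; last by rewrite -natr1; ring.
  by rewrite (le_trans (gC _))// exprS -mulrA ler_wpM2l// ltW.
have [n an] : exists n : nat, (`|a| <= n%:R)%R.
  by exists (Num.truncn `|a|).+1; rewrite ltW// truncnS_gt.
have Cn_gt0 : (0 < C ^+ n)%R by rewrite exprn_gt0.
have ratioE x : ccdf X (x + a)%R / ccdf X x = (g (x + a) / g x)%:E.
  by rewrite !gE inver gt_eqF.
split; last 1 first.
- apply: (@le_lt_trans _ _ (C ^+ n)%:E); last by rewrite ltry.
  rewrite limf_esupE; apply: ge_ereal_inf.
  exists (ereal_sup (range (fun x => ccdf X (x + a)%R / ccdf X x))).
    by exists setT => //; exact: filterT.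
  apply: ge_ereal_sup => _ [x _ <-]; rewrite ratioE lee_fin ler_pdivrMr//.
  apply: le_trans (gCn n x); apply: g_le.
  by move: an; rewrite ler_norml => /andP[]; lra.
- apply: (@lt_le_trans _ _ (C ^+ n)^-1%:E); first by rewrite lte_fin invr_gt0.
  rewrite limf_einfE; apply: le_ereal_sup_tmp.
  exists (ereal_inf (range (fun x => ccdf X (x + a)%R / ccdf X x))).
    by exists setT => //; exact: filterT.
  apply: le_ereal_inf_tmp => _ [x _ <-]; rewrite ratioE lee_fin.
  rewrite ler_pdivlMr// mulrC ler_pdivrMr// mulrC.
  apply: le_trans (gCn n (x + a)%R); apply: g_le.
  by move: an; rewrite ler_norml => /andP[]; lra.
- exact: limf_einf_le_esup.
Qed.

End OL_cdf.

(** * Tails of sums of two independent variables *)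

Section convolution.
Context d (T : measurableType d) (R : realType) (P : probability T R).

Lemma ccdf_addE (X Y : {RV P >-> R}) :
  (forall A B : set R, measurable A -> measurable B ->
    P (X @^-1` A `&` Y @^-1` B) = P (X @^-1` A) * P (Y @^-1` B)) ->
  forall x, P [set w | (x < X w + Y w)%R] =
            \int[distribution P Y]_y ccdf X (x - y)%R.
Proof.
move=> XY x.
have mYX : measurable_fun setT (fun w => (Y w, X w)).
  exact/measurable_fun_pair.
pose YX : {RV P >-> (R * R)%type} := [the {mfun _ >-> _} of
  mfun_Sub (mem_set mYX)].
pose E := [set z : R * R | (x < z.2 + z.1)%R].
have mE : measurable E.
  rewrite -[E]setTI (_ : E = (fun z : R * R => (z.2 + z.1)%R) @^-1` `]x, +oo[).
    by apply: measurable_funD => //; exact: measurable_itv.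
  by apply/seteqP; split=> z /=; rewrite in_itv/= andbT.
transitivity (distribution P YX E) => //.
(* The joint law agrees with the product of the marginals on rectangles, hence everywhere. With [Y]
   as first coordinate, the product measure integrates over the law of [Y] the mass that the law of
   [X] gives to sections. *)
rewrite -(@product_measure_unique _ _ _ _ _
  (distribution P Y) (distribution P X) (distribution P YX))//.
  rewrite /product_measure1; apply: eq_integral => y _ /=.
  rewrite /ccdf; congr (distribution P X _).
  by apply/seteqP; split=> z /=; rewrite /xsection/= inE/E/= in_itv/= andbT ltrBlDr.
by move=> A B mA mB; rewrite muleC -XY// setIC.
Qed.

(** By the convolution formula it suffices to compare integrands, and for each [y] this is the
    inequality for [X] at the point [x - y]. *)
Lemma ccdf_add_le (X Y : {RV P >-> R}) (C : R) : (0 <= C)%R ->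
  (forall A B : set R, measurable A -> measurable B ->
    P (X @^-1` A `&` Y @^-1` B) = P (X @^-1` A) * P (Y @^-1` B)) ->
  (forall x, ccdf X (x - 1)%R <= C%:E * ccdf X x) ->
  forall x, P [set w | (x - 1 < X w + Y w)%R] <=
            C%:E * P [set w | (x < X w + Y w)%R].
Proof.
move=> C_ge0 XY XC x; rewrite !ccdf_addE//.
have mccdf (z : R) : measurable_fun setT (fun y : R => ccdf X (z - y)%R).
  apply: (measurableT_comp (ccdf_measurable X)).
  exact: measurable_funB.
rewrite -ge0_integralZl_EFin//; apply: ge0_le_integral => //.
  exact/measurable_funeM.
by move=> y _; rewrite addrAC.
Qed.

End convolution.

(** * From finite product formulas to generated sigma-algebras *)

Section independence.
Context d (T : measurableType d) (R : realType) (P : probability T R).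
Variables (I : choiceType) (D : set I) (X : I -> {RV P >-> R}).

(** Unlike the single preimages that generate [generated_sigma], these sets are closed under
    intersection, as uniqueness of measures requires. *)
Let cylinders : set (set T) := [set E | exists (J : {fset I}) (B : I -> set R),
  [/\ [set` J] `<=` D, (forall i, measurable (B i)) &
      E = \bigcap_(i in [set` J]) X i @^-1` B i]].

Let cylindersI : setI_closed cylinders.
Proof.
move=> _ _ [J [B [JD mB ->]]] [K [C [KD mC ->]]].
exists (J `|` K)%fset.
(* The full line stands in outside [J] and outside [K], so one family over the union encodes both
   conditions. *)
exists (fun i =>
  (if i \in J then B i else setT) `&` (if i \in K then C i else setT)).
split=> [i /= /fsetUP[/JD|/KD]//|i|].
  by apply: measurableI; case: ifP.
apply/seteqP; split=> w /=.
- by move=> [BJ CK] i /=; split; case: ifP => // iK; [exact: BJ|exact: CK].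
- move=> BC; split=> i /= iJ.
  + by have := BC i; rewrite /= in_fsetU iJ => /(_ isT)[].
  + by have := BC i; rewrite /= in_fsetU iJ orbT => /(_ isT)[].
Qed.

Let generated_sub_cylinders : generated_sigma D X `<=` <<s cylinders >>.
Proof.
apply: smallest_sub; first exact: smallest_sigma_algebra.
move=> _ [i Di [B mB <-]]; apply: sub_sigma_algebra.
exists [fset i]%fset; exists (fun=> B); split => //.
  by move=> j /= /fset1P ->.
rewrite setTI; apply/seteqP; split=> [w Bw j /fset1P ->//|w].
by apply; exact/fset11.
Qed.

Lemma mutually_independent_generated (i : I) (A : set R) (E : set T) :
  ~ D i -> mutually_independent (i |` D) X ->
  measurable A -> generated_sigma D X E ->
  P (X i @^-1` A `&` E) = P (X i @^-1` A) * P E.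
Proof.
move=> Di indep mA /generated_sub_cylinders sE.
have mXA : measurable (X i @^-1` A).
  by rewrite -[X in measurable X]setTI; exact: measurable_funPT.
pose p := fine (P (X i @^-1` A)).
have p_ge0 : (0 <= p)%R by rewrite fine_ge0.
have pE : P (X i @^-1` A) = p%:E by rewrite fineK// fin_num_measure.
rewrite setIC pE.
(* Both sides are finite measures of [E] that agree on the cylinders. *)
apply: (g_sigma_algebra_measure_unique cylinders _ (fun=> setT) _ _
  (mrestr P mXA) (mscale (NngNum p_ge0) P)) => //.
- move=> _ [J [B [_ mB ->]]]; apply: fin_bigcap_measurable => // j _.
  by rewrite -[X in measurable X]setTI; exact: measurable_funPT.
- by move=> _; exists fset0, (fun=> setT); split => //; rewrite set_fset0 bigcap_set0.
- by rewrite bigcup_const//; exists 0%N.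
- move=> _ [J [B [JD mB ->]]].
  have iJ : i \notin J by apply/negP => /JD.
  (* Since [i] is not in [J], inserting [A] at [i] leaves the cylinder over [J] unchanged. The
     product formula then applies over [J] and over [J] with [i] added. *)
  pose B' j := if j == i then A else B j.
  have B'J j : j \in J -> B' j = B j.
    by rewrite /B'; case: eqVneq => // ->; rewrite (negbTE iJ).
  have mB' j : measurable (B' j) by rewrite /B'; case: ifP.
  set E' := \bigcap_(j in _) _.
  suff : P (X i @^-1` A `&` E') = P (X i @^-1` A) * P E'.
    by rewrite pE setIC.
  have B'i : B' i = A by rewrite /B' eqxx.
  have E'E : E' = \bigcap_(j in [set` J]) X j @^-1` B' j.
    by apply: eq_bigcapr => j /B'J ->.
  have iE : X i @^-1` A `&` E' = \bigcap_(j in [set` (i |` J)%fset]) X j @^-1` B' j.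
    by rewrite E'E -B'i set_fsetU set_fset1 bigcap_setU bigcap_set1.
  rewrite iE E'E indep//; last by move=> j /= /fset1UP[->|/JD ?]; [left|right].
  by rewrite indep// ?big_fsetU1//= ?B'i// => j /JD ?; right.
- by move=> _; rewrite ltey_eq fin_num_measure.
Qed.

Lemma generated_sigma_sum (s : seq I) (B : set R) : {in s, forall i, D i} ->
  measurable B ->
  generated_sigma D X ((fun w => \sum_(i <- s) X i w)%R @^-1` B).
Proof.
move=> + mB.
(* On [T] re-equipped with the generated sigma-algebra, the claim becomes ordinary measurability of
   a finite sum. *)
pose GT := g_sigma_algebraType
  (\bigcup_(i in D) preimage_set_system [set: T] (X i) measurable).
suff H : {in s, forall i, D i} ->
    measurable_fun [set: GT] (fun w : GT => \sum_(i <- s) X i w)%R.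
  by move=> /H /(_ measurableT _ mB); rewrite setTI.
elim: s => [_|i s IH sD].
  apply: (eq_measurable_fun (cst 0%R : GT -> R)) => [w _|].
    by rewrite big_nil.
  exact: measurable_cst.
apply: (eq_measurable_fun (fun w : GT => X i w + \sum_(j <- s) X j w)%R) => [w _|].
  by rewrite big_cons.
apply: measurable_funD; last by apply: IH => j js; apply: sD; rewrite inE js orbT.
move=> _ A mA; apply: sub_sigma_algebra.
by exists i; [apply: sD; rewrite inE eqxx|exists A].
Qed.

End independence.

(** * Partial sums with at least [kappa] terms *)

Section partial_sums.
Context d (T : measurableType d) (R : realType) (P : probability T R).
Variable xi : nat -> {RV P >-> R}.

Let S n w := (\sum_(1 <= k < n.+1) xi k w)%R.

Lemma measurable_sum_gt n x : measurable [set w | (x < S n w)%R].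
Proof.
suff /(_ measurableT `]x, +oo[%classic (measurable_itv _)) : measurable_fun setT (S n).
  by rewrite setTI preimage_itvoy.
exact: measurable_sum.
Qed.

Lemma prob_sum_gt_le (kappa n : nat) (C : R) :
  mutually_independent [set k | (1 <= k)%N] xi -> (1 <= kappa <= n)%N ->
  (0 <= C)%R -> (forall x, ccdf (xi kappa) (x - 1)%R <= C%:E * ccdf (xi kappa) x) ->
  forall x, P [set w | (x - 1 < S n w)%R] <= C%:E * P [set w | (x < S n w)%R].
Proof.
move=> indep /andP[kappa1 kappan] C0 kC x.
(* The sum of the other terms is measurable for the sigma-algebra of the indices in [D], hence
   independent of [xi kappa]. *)
pose s := [seq k <- index_iota 1 n.+1 | k != kappa].
have mY : measurable_fun [set: T] (fun w => \sum_(k <- s) xi k w)%R.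
  exact: measurable_sum.
pose Y : {RV P >-> R} := [the {mfun _ >-> _} of mfun_Sub (mem_set mY)].
pose D := [set k | (1 <= k)%N /\ k != kappa].
have DE : kappa |` D = [set k | (1 <= k)%N].
  apply/seteqP; split=> k /=; first by move=> [->|[]].
  by have [->|kk k1] := eqVneq k kappa; [left|right].
have SE w : S n w = (xi kappa w + Y w)%R.
  rewrite /S (bigD1_seq kappa) ?iota_uniq//=; last by rewrite mem_index_iota kappa1.
  by rewrite /s big_filter.
under eq_set do rewrite SE; under [in leRHS]eq_set do rewrite SE.
apply: ccdf_add_le => // A B mA mB.
apply: (@mutually_independent_generated _ _ _ _ _ D) => //.
- by rewrite /D /= eqxx; case.
- by rewrite DE.
- apply: generated_sigma_sum => // k.
  by rewrite mem_filter mem_index_iota => /andP[? /andP[]].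
Qed.

End partial_sums.

(** * The random sum *)

Theorem theorem6 (R : realType) (d : measure_display) (T : measurableType d)
  (P : probability T R) (xi : nat -> {RV P >-> R}) (eta : {RV P >-> nat})
  (xi_ge0 : forall k w, (1 <= k)%N -> (0 <= xi k w)%R)
  (xi_indep : mutually_independent [set k | (1 <= k)%N] xi)
  (eta_counting : counting_RV eta)
  (eta_indep : independent_of_family eta [set k | (1 <= k)%N] xi)
  (kappa : nat) (kappa_supp : kappa \in supp eta `\ 0%N)
  (h1 : OL (cdf (xi kappa)))
  (h2 : forall k, k \in supp eta -> (1 <= k <= kappa)%N ->
    (tail (cdf (xi k)) x / tail (cdf (xi kappa)) x @[x --> +oo%R] --> 0)
    \/ OL (cdf (xi k)))
  (h3 : limf_esup (fun x : R =>
      ereal_sup [set tail (cdf (xi (kappa + k)%N)) (x - 1)%R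
                     / tail (cdf (xi (kappa + k)%N)) x
                | k in [set k | (1 <= k)%N]]) +oo%R < +oo)
  (h4 : limn_esup (fun k : nat =>
      (k%:R^-1)%:E * \sum_(1 <= l < k.+1)
        ereal_sup [set tail (cdf (xi (kappa + l)%N)) (x - 1)%R
                       - tail (cdf (xi (kappa + l)%N)) x
                  | x in [set x : R | (0 <= x)%R]]) < 1)
  (h5 : forall delta : R, (0 < delta < 1)%R ->
    ((fun x : R => fine (tail (cdf (nat_RV eta)) (delta * x))) =O_ +oo
     (fun x : R => Num.sqrt x * fine (tail (cdf (xi kappa)) x)))%R) :
  OL (cdf (random_sum xi eta)).
Proof.
have [kappa_gt0 kappa0] : 0 < P (eta @^-1` [set kappa]) /\ (1 <= kappa)%N.
  by move: kappa_supp; rewrite inE => -[? /eqP]; rewrite -lt0n; split.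
have [xi_gt0 [C C0 xiC]] := OL_ccdf_le h1.
pose S n w := (\sum_(1 <= k < n.+1) xi k w)%R.
(* For fixed [x] these events are disjoint in [n], and on [E n x] the random sum equals [S n]. *)
pose E n x := eta @^-1` [set n] `&` [set w | (x < S n w)%R].
have meta n : measurable (eta @^-1` [set n]).
  by rewrite -[X in measurable X]setTI; exact: measurable_funPT.
have mE n x : measurable (E n x).
  by apply: measurableI => //; exact: measurable_sum_gt.
have PE n x : P (E n x) = P (eta @^-1` [set n]) * P [set w | (x < S n w)%R].
  apply: eta_indep => //.
  rewrite (_ : [set w | _] = S n @^-1` `]x, +oo[); last by rewrite preimage_itvoy.
  by apply: generated_sigma_sum => // k; rewrite mem_index_iota => /andP[].
have ccdfE x : ccdf (random_sum xi eta) x =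
    P [set w | (x < random_sum_fun xi eta w)%R].
  by rewrite /ccdf /distribution /pushforward preimage_itvoy.
have mS x : measurable [set w | (x < random_sum_fun xi eta w)%R].
  by rewrite -preimage_itvoy -[X in measurable X]setTI; exact: measurable_funPT.
have E_le n x : P (E n x) <= ccdf (random_sum xi eta) x.
  by rewrite ccdfE le_measure ?inE// => w [/= <-].
have tailS n x : (kappa <= n)%N ->
    P [set w | (x - 1 < S n w)%R] <= C%:E * P [set w | (x < S n w)%R].
  by move=> kn; apply: prob_sum_gt_le xiC x => //; rewrite kappa0.
have S_homo m n w : (m <= n)%N -> (S m w <= S n w)%R.
  move=> mn; rewrite /S (@big_cat_nat _ _ _ m.+1 1 n.+1)//= lerDl.
  by rewrite big_nat sumr_ge0// => k /andP[mk _]; apply: xi_ge0; exact: leq_trans mk.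
pose p := fine (P (eta @^-1` [set kappa])).
have pE : P (eta @^-1` [set kappa]) = p%:E by rewrite fineK// fin_num_measure.
have p_gt0 : (0 < p)%R by rewrite -lte_fin -pE.
have S_le x : P [set w | (x < S kappa w)%R] <= p^-1%:E * ccdf (random_sum xi eta) x.
  rewrite -(@lee_pmul2l _ p%:E)// muleA -EFinM divff ?gt_eqF// mul1e -pE -PE.
  exact: E_le.
(* The summand [C * p^-1] pays for the outcomes with [eta < kappa], through [S_le], and [C] for
   those with [eta >= kappa]. *)
apply: (@ccdf_le_OL _ _ _ _ (random_sum xi eta) (C * p^-1 + C)%R) => x.
  apply: lt_le_trans (E_le kappa x); rewrite PE mule_gt0//.
  apply: lt_le_trans (xi_gt0 x) _.
  rewrite /ccdf /distribution /pushforward preimage_itvoy le_measure ?inE//.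
  - by rewrite -preimage_itvoy -[X in measurable X]setTI; exact: measurable_funPT.
  - exact: measurable_sum_gt.
  (* The term [xi kappa] is the last one of [S kappa], and the earlier ones are nonnegative. *)
  move=> w /= xw; apply: lt_le_trans xw _; rewrite /S big_nat_recr//= lerDr.
  by rewrite big_nat sumr_ge0// => k /andP[k1 _]; exact: xi_ge0.
have tE y : trivIset [set n | (kappa <= n)%N] (E ^~ y).
  by move=> m n _ _ [w [[/= <- _] [/= <- _]]].
have cover : [set w | (x - 1 < random_sum_fun xi eta w)%R] `<=`
    [set w | (x - 1 < S kappa w)%R] `|`
    \bigcup_(n in [set n | (kappa <= n)%N]) E n (x - 1)%R.
  move=> w /= xw; have [kw|wk] := leqP kappa (eta w).
    by right; exists (eta w).
  by left; apply: lt_le_trans xw _; exact/S_homo/ltnW.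
have mU y : measurable (\bigcup_(n in [set n | (kappa <= n)%N]) E n y).
  by apply: bigcup_measurable => n _; exact: mE.
have large_le : P (\bigcup_(n in [set n | (kappa <= n)%N]) E n (x - 1)%R) <=
    C%:E * ccdf (random_sum xi eta) x.
  apply: (@le_trans _ _ (C%:E * P (\bigcup_(n in [set n | (kappa <= n)%N]) E n x))).
    (* Countable additivity reduces the bound to single values of [n], where independence of [eta]
       factors out [P (eta = n)]; the constant [C] is the same for all of them. *)
    rewrite !measure_bigcup// -nneseriesZl//; apply: lee_nneseries => // n.
    rewrite inE /= => kn; rewrite !PE muleCA; apply: lee_wpmul2l => //.
    exact: tailS.
  rewrite lee_wpmul2l ?lee_fin// ccdfE le_measure ?inE//.
  by move=> w [n _ [/= <-]].
rewrite [leLHS]ccdfE; apply: (@le_trans _ _ _ _ _ (le_measure P _ _ cover)).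
  by rewrite inE.
  by rewrite inE; apply: measurableU => //; exact: measurable_sum_gt.
apply: le_trans (measureU2 _ _ _) _ => //; first exact: measurable_sum_gt.
rewrite EFinD ge0_muleDl ?lee_fin ?divr_ge0// ?(ltW p_gt0)//.
apply: leeD => //; apply: (le_trans (tailS _ _ (leqnn _))).
by rewrite EFinM -muleA lee_wpmul2l ?lee_fin.
Qed.
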